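(* Let $p>q>1$ be relatively prime integers and let $\epsilon>0$. Then there exists a finite union of intervals $K\subseteq[0,1)$ of total length at least $1-\epsilon$ such that $Z_{p/q}(K)=\emptyset$.
   Context: For $x\in\mathbb{R}$, $\{x\}=x-\lfloor x\rfloor$ denotes the fractional part. For relatively prime integers $p>q>1$ and $S\subseteq[0,1)$, $Z_{p/q}(S)=\{\xi>0 \mid \{\xi (p/q)^i\}\in S \text{ for every } i\in\mathbb{N}\}$, where $\mathbb{N}=\{0,1,2,\dots\}$. *)

(* Defs.v *)
From Stdlib Require Import Reals ZArith List.
Open Scope R_scope.

(* Fractional part {x} = x - floor x  (Stdlib: Int_part x = up x - 1 = floor x). *)
Definition frac (x : R) : R := x - IZR (Int_part x).

Definition Zpq (p q : Z) (S : R -> Prop) (xi : R) : Prop :=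
  0 < xi /\ forall i : nat, S (frac (xi * (IZR p / IZR q) ^ i)).

Record interval := mkInterval { lo : R; hi : R; lo_closed : bool; hi_closed : bool }.

Definition in_interval (I : interval) (x : R) : Prop :=
  (if lo_closed I then lo I <= x else lo I < x) /\
  (if hi_closed I then x <= hi I else x < hi I).

Definition ilength (I : interval) : R := hi I - lo I.

Definition union_of (L : list interval) (x : R) : Prop :=
  exists I, In I L /\ in_interval I x.

Definition pairwise_disjoint (L : list interval) : Prop :=
  forall (i j : nat) (d : interval) (x : R), (i < length L)%nat -> (j < length L)%nat ->
    i <> j -> in_interval (nth i L d) x -> in_interval (nth j L d) x -> False.

Definition total_length (L : list interval) : R :=
  fold_right (fun I acc => ilength I + acc) 0 L.

(* Main.v *)
(** Replace [p], [q] by powers [P], [Q] of them and fix [k].  For real [x] and [0 <= j <= k]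
    let [d_j(x)] be the first base-[P] digit of the fractional part of [P^j Q^(k-j) x].
    Since [P] and [Q] are coprime, the [d_j] are independent and uniform on [{0, ..., P-1}], so
    the set of [x] with no [d_j(x) = 0] has measure [(1 - 1/P)^(k+1)].  Let [K] consist of the [x]
    with [d_0(x) <> 0] and [d_j(x) = 0] for some [j]; its measure tends to [1] as first [k] and then
    [P] grow.  As [Q^k (P/Q)^j = P^j Q^(k-j)] is an integer, [d_j] of [{xi}] is [d_0] of
    [{xi (P/Q)^j}], so no orbit stays inside [K]. *)
Require Import Defs.
From Stdlib Require Import Reals ZArith List Lia Lra Znumtheory Zpow_facts.
Open Scope R_scope.

(** * Finite counting and nested integer parts *)

Lemma length_le_of_injection (A B : Type) (f : A -> B) (l : list A) (l' : list B) :
  NoDup l -> (forall x, In x l -> In (f x) l') ->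
  (forall x y, In x l -> In y l -> f x = f y -> x = y) ->
  (length l <= length l')%nat.
Proof.
  intros Hl Hin Hinj. rewrite <- (length_map f l). apply NoDup_incl_length.
  - clear Hin. induction Hl as [|a l Ha Hl IH]; simpl; constructor.
    + intros H. apply in_map_iff in H as [y [Hy Hy']].
      apply Ha. rewrite <- (Hinj y a); simpl; auto.
    + apply IH. intros; apply Hinj; simpl; auto.
  - intros b Hb. apply in_map_iff in Hb as [x [<- Hx]]. auto.
Qed.

Fixpoint words {A : Type} (l : list A) (n : nat) : list (list A) :=
  match n with
  | O => nil :: nil
  | S n => map (fun c => fst c :: snd c) (list_prod l (words l n))
  end.

Lemma length_words (A : Type) (l : list A) (n : nat) :
  length (words l n) = (length l ^ n)%nat.
Proof.
  induction n as [|n IH]; simpl; [reflexivity|].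
  now rewrite length_map, length_prod, IH.
Qed.

Lemma in_words (A : Type) (l w : list A) : incl w l -> In w (words l (length w)).
Proof.
  induction w as [|a w IH]; intros H; simpl; [now left|].
  apply in_map_iff. exists (a, w). split; [reflexivity|].
  apply in_prod; [apply H; now left|apply IH; intros b Hb; apply H; now right].
Qed.

Definition zrange (n : Z) : list Z := map Z.of_nat (seq 0 (Z.to_nat n)).

Lemma in_zrange (n z : Z) : In z (zrange n) <-> (0 <= z < n)%Z.
Proof.
  unfold zrange. rewrite in_map_iff. split.
  - intros [x [<- Hx]]. apply in_seq in Hx. lia.
  - intros H. exists (Z.to_nat z). rewrite in_seq. lia.
Qed.

Lemma NoDup_zrange (n : Z) : NoDup (zrange n).
Proof.
  unfold zrange. apply NoDup_map_NoDup_ForallPairs; [|apply seq_NoDup].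
  intros x y _ _. lia.
Qed.

Lemma length_zrange (n : Z) : length (zrange n) = Z.to_nat n.
Proof. unfold zrange. now rewrite length_map, length_seq. Qed.

Lemma length_filter_orb_le (A : Type) (f g h : A -> bool) (l : list A) :
  (forall x, f x || g x || h x = true)%bool ->
  (length l <= length (filter f l) + length (filter g l) + length (filter h l))%nat.
Proof.
  intros H. induction l as [|a l IH]; simpl; [lia|].
  specialize (H a). destruct (f a), (g a), (h a); simpl in *; try discriminate; lia.
Qed.

(** Nested floors: if [m] is the integer part of [b F x], then [m / b] is that of [F x]. This turns
    a grid index into a statement about one digit. *)
Lemma floor_div (m b F : Z) (x : R) : (0 < b)%Z ->
  IZR m <= IZR (b * F) * x < IZR (m + 1) ->
  IZR (m / b) <= IZR F * x < IZR (m / b + 1).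
Proof.
  intros Hb [H1 H2]. pose proof (IZR_lt _ _ Hb) as Hb'.
  rewrite mult_IZR in H1, H2.
  pose proof (Z.div_mod m b ltac:(lia)) as E.
  pose proof (Z.mod_pos_bound m b Hb) as B.
  split; apply Rmult_le_reg_l with (IZR b) || apply Rmult_lt_reg_l with (IZR b); auto.
  - rewrite <- mult_IZR. assert (IZR (b * (m / b)) <= IZR m) by (apply IZR_le; lia). lra.
  - rewrite <- mult_IZR. assert (IZR (m + 1) <= IZR (b * (m / b + 1))) by (apply IZR_le; lia). lra.
Qed.

(** * Digits of grid indices and their independence *)

Section Digits.

Variables (P Q : Z) (k : nat).
Hypotheses (HP : (1 < P)%Z) (HQ : (0 < Q)%Z) (HPQ : rel_prime P Q).

(** A common denominator: every [d_j] is constant on each interval from [m / grid] to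
    [(m + 1) / grid]. *)
Definition grid : Z := (P ^ Z.of_nat (S k) * Q ^ Z.of_nat k)%Z.

(* With [m] the integer part of [grid * x], this is the digit [d_(k-e)(x)] of the header. *)
Definition digit (e : nat) (m : Z) : Z :=
  ((m / (P ^ Z.of_nat e * Q ^ Z.of_nat (k - e))) mod P)%Z.

Lemma pow_P_pos (e : nat) : (0 < P ^ Z.of_nat e)%Z.
Proof. apply Z.pow_pos_nonneg; lia. Qed.

Lemma pow_Q_pos (e : nat) : (0 < Q ^ Z.of_nat e)%Z.
Proof. apply Z.pow_pos_nonneg; lia. Qed.

Lemma grid_pos : (0 < grid)%Z.
Proof. unfold grid. pose proof (pow_P_pos (S k)). pose proof (pow_Q_pos k). nia. Qed.

(** Independence of the digits in counting form. Congruence modulo [P^e Q^k] gains one factor [P]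
    from each digit; after [k + 1] digits the modulus is [grid]. *)
Lemma digits_determine (m m' : Z) :
  (0 <= m < grid)%Z -> (0 <= m' < grid)%Z ->
  (m mod Q ^ Z.of_nat k = m' mod Q ^ Z.of_nat k)%Z ->
  (forall e, (e <= k)%nat -> digit e m = digit e m') -> m = m'.
Proof.
  intros Hm Hm' H0 Hd.
  assert (Hdiv : forall e, (e <= S k)%nat ->
            exists t, m = (m' + P ^ Z.of_nat e * Q ^ Z.of_nat k * t)%Z).
  { induction e as [|e IH]; intros He.
    - exists (m / Q ^ Z.of_nat k - m' / Q ^ Z.of_nat k)%Z.
      pose proof (pow_Q_pos k) as HQk.
      pose proof (Z.div_mod m (Q ^ Z.of_nat k) ltac:(lia)).
      pose proof (Z.div_mod m' (Q ^ Z.of_nat k) ltac:(lia)).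
      change (Z.of_nat 0) with 0%Z. rewrite Z.pow_0_r. nia.
    - destruct IH as [t Ht]; [lia|].
      specialize (Hd e ltac:(lia)). unfold digit in Hd.
      set (b := (P ^ Z.of_nat e * Q ^ Z.of_nat (k - e))%Z) in *.
      assert (Hb : (0 < b)%Z).
      { unfold b. pose proof (pow_P_pos e). pose proof (pow_Q_pos (k - e)). nia. }
      assert (Hsplit : (Q ^ Z.of_nat k = Q ^ Z.of_nat (k - e) * Q ^ Z.of_nat e)%Z).
      { rewrite <- Z.pow_add_r by lia. f_equal. lia. }
      assert (Ht' : m = (m' + Q ^ Z.of_nat e * t * b)%Z).
      { rewrite Ht, Hsplit. unfold b. ring. }
      rewrite Ht', Z.div_add in Hd by lia.
      (* The quotients of [m] and [m'] by [b] differ by exactly [Q^e t], so equal digits make it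
         divisible by [P]; coprimality then gives [P | t]. *)
      assert (Hdvd : (P | Q ^ Z.of_nat e * t)%Z).
      { apply Z.mod_divide; [lia|].
        replace (Q ^ Z.of_nat e * t)%Z
          with ((m' / b + Q ^ Z.of_nat e * t) - m' / b)%Z by ring.
        rewrite Zminus_mod, Hd, Z.sub_diag. apply Z.mod_0_l. lia. }
      apply Gauss in Hdvd.
      + destruct Hdvd as [u ->]. exists u. rewrite Ht.
        rewrite (Nat2Z.inj_succ e), Z.pow_succ_r by lia. ring.
      + apply rel_prime_Zpower_r; [lia|assumption]. }
  destruct (Hdiv (S k) ltac:(lia)) as [t Ht].
  fold grid in Ht. pose proof grid_pos.
  assert (t = 0)%Z by nia. subst t. lia.
Qed.

(** * Counting good and bad indices *)

Definition no_zero_digit (m : Z) : bool :=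
  forallb (fun e => negb (digit e m =? 0)%Z) (seq 0 (S k)).

(** By [digits_determine], the residue modulo [Q^k] and the word of [k + 1] digits encode [m]
    injectively; each digit has only the values [1, ..., P - 1]. *)
Lemma count_no_zero_digit :
  (length (filter no_zero_digit (zrange grid))
   <= Z.to_nat (Q ^ Z.of_nat k) * Z.to_nat (P - 1) ^ S k)%nat.
Proof.
  replace (Z.to_nat (Q ^ Z.of_nat k) * Z.to_nat (P - 1) ^ S k)%nat
    with (length (list_prod (zrange (Q ^ Z.of_nat k))
                            (words (map Z.succ (zrange (P - 1))) (S k))))
    by now rewrite length_prod, length_words, length_map, !length_zrange.
  apply (length_le_of_injection _ _
    (fun m => (m mod Q ^ Z.of_nat k, map (fun e => digit e m) (seq 0 (S k)))%Z)).
  - apply NoDup_filter, NoDup_zrange.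
  - intros m Hm. apply filter_In in Hm as [_ Hm].
    apply in_prod.
    + apply in_zrange, Z.mod_pos_bound, pow_Q_pos.
    + set (w := map _ _).
      replace (S k) with (length w) by (unfold w; now rewrite length_map, length_seq).
      apply in_words. intros d Hd. apply in_map_iff in Hd as [e [<- He]].
      unfold no_zero_digit in Hm. rewrite forallb_forall in Hm. specialize (Hm e He).
      apply Bool.negb_true_iff, Z.eqb_neq in Hm.
      pose proof (Z.mod_pos_bound (m / (P ^ Z.of_nat e * Q ^ Z.of_nat (k - e))) P
                    ltac:(lia)) as Hb.
      fold (digit e m) in Hb.
      apply in_map_iff. exists (digit e m - 1)%Z. rewrite in_zrange. lia.
  - intros m m' Hm Hm' Heq. apply pair_equal_spec in Heq as [H0 Hd].
    apply filter_In in Hm as [Hm _]. apply filter_In in Hm' as [Hm' _].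
    apply in_zrange in Hm, Hm'.
    apply digits_determine; auto.
    intros e He.
    apply (ext_in_map Hd). apply in_seq. lia.
Qed.

(** For [e = k] the divisor is [P^k], so this is an ordinary base-[P] digit of [m]; when it is zero,
    the part above and the part below it recover [m]. *)
Lemma count_top_digit_zero :
  (length (filter (fun m => digit k m =? 0)%Z (zrange grid))
   <= Z.to_nat (Q ^ Z.of_nat k) * Z.to_nat (P ^ Z.of_nat k))%nat.
Proof.
  rewrite <- (length_zrange (Q ^ _)), <- (length_zrange (P ^ _)), <- length_prod.
  pose proof (pow_P_pos k) as HPk.
  assert (HPS : (P ^ Z.of_nat (S k) = P ^ Z.of_nat k * P)%Z).
  { rewrite Nat2Z.inj_succ, Z.pow_succ_r by lia. ring. }
  apply (length_le_of_injection _ _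
    (fun m => (m / P ^ Z.of_nat (S k), m mod P ^ Z.of_nat k)%Z)).
  - apply NoDup_filter, NoDup_zrange.
  - intros m Hm. apply filter_In in Hm as [Hm _]. apply in_zrange in Hm.
    apply in_prod; apply in_zrange.
    + pose proof (pow_P_pos (S k)). split.
      * apply Z.div_pos; lia.
      * apply Z.div_lt_upper_bound; [lia|]. unfold grid in Hm. lia.
    + apply Z.mod_pos_bound, HPk.
  - intros m m' Hm Hm' Heq. apply pair_equal_spec in Heq as [Hq Hr].
    apply filter_In in Hm as [_ Hm]. apply filter_In in Hm' as [_ Hm'].
    apply Z.eqb_eq in Hm, Hm'. unfold digit in Hm, Hm'.
    rewrite Nat.sub_diag, Z.pow_0_r, Z.mul_1_r in Hm, Hm'.
    rewrite HPS, <- !Z.div_div in Hq by lia.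
    pose proof (Z.div_mod m (P ^ Z.of_nat k) ltac:(lia)) as E1.
    pose proof (Z.div_mod m' (P ^ Z.of_nat k) ltac:(lia)) as E2.
    pose proof (Z.div_mod (m / P ^ Z.of_nat k) P ltac:(lia)) as E3.
    pose proof (Z.div_mod (m' / P ^ Z.of_nat k) P ltac:(lia)) as E4.
    rewrite Hm in E3. rewrite Hm' in E4. rewrite Hq in E3. rewrite <- E4 in E3.
    rewrite E3, Hr in E1. now rewrite <- E2 in E1.
Qed.

Definition good (m : Z) : bool :=
  negb (digit k m =? 0)%Z && negb (no_zero_digit m).

Lemma count_good :
  IZR grid - IZR (Q ^ Z.of_nat k * P ^ Z.of_nat k) - IZR (Q ^ Z.of_nat k * (P - 1) ^ Z.of_nat (S k))
  <= INR (length (filter good (zrange grid))).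
Proof.
  rewrite INR_IZR_INZ, <- !minus_IZR. apply IZR_le.
  pose proof (length_filter_orb_le _ good (fun m => digit k m =? 0)%Z no_zero_digit (zrange grid)) as H.
  rewrite length_zrange in H.
  pose proof count_no_zero_digit as H1. pose proof count_top_digit_zero as H2.
  specialize (H ltac:(intros m; unfold good; destruct (digit k m =? 0)%Z, (no_zero_digit m); reflexivity)).
  pose proof (pow_P_pos k). pose proof (pow_Q_pos k). pose proof grid_pos.
  apply Nat2Z.inj_le in H1, H2.
  rewrite Nat2Z.inj_mul, Nat2Z.inj_pow, !Z2Nat.id in H1 by lia.
  rewrite Nat2Z.inj_mul, !Z2Nat.id in H2 by lia.
  lia.
Qed.

(** * The set [K] as a union of grid cells, and its length *)

Definition cell (m : Z) : interval :=
  mkInterval (IZR m / IZR grid) (IZR (m + 1) / IZR grid) true false.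

(** Half-open cells make [m] exactly the integer part of [grid * x], the form that [floor_div]
    takes. *)
Lemma in_cell (m : Z) (x : R) :
  in_interval (cell m) x <-> IZR m <= IZR grid * x < IZR (m + 1).
Proof.
  pose proof (IZR_lt _ _ grid_pos) as HN.
  unfold in_interval, cell; simpl.
  assert (E : forall z, IZR z / IZR grid * IZR grid = IZR z) by (intros; field; lra).
  pose proof (E m). pose proof (E (m + 1)%Z). split; intros [H1 H2]; split; nra.
Qed.

Lemma cell_unique (m m' : Z) (x : R) :
  in_interval (cell m) x -> in_interval (cell m') x -> m = m'.
Proof.
  rewrite !in_cell. intros [H1 H2] [H3 H4].
  assert (m < m' + 1)%Z by (apply lt_IZR; lra).
  assert (m' < m + 1)%Z by (apply lt_IZR; lra). lia.
Qed.

Definition cells : list interval := map cell (filter good (zrange grid)).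

Lemma union_cells (x : R) :
  union_of cells x <->
  exists m, (0 <= m < grid)%Z /\ good m = true /\ IZR m <= IZR grid * x < IZR (m + 1).
Proof.
  unfold union_of, cells. split.
  - intros [I [HI Hx]]. apply in_map_iff in HI as [m [<- Hm]].
    apply filter_In in Hm as [Hm Hg]. apply in_zrange in Hm. apply in_cell in Hx. eauto.
  - intros [m [Hm [Hg Hx]]]. exists (cell m). split; [|now apply in_cell].
    apply in_map, filter_In. now rewrite in_zrange.
Qed.

Lemma cells_disjoint : pairwise_disjoint cells.
Proof.
  intros i j d x Hi Hj Hij. unfold cells in *. rewrite length_map in Hi, Hj.
  (* The indices are in range, so the default may be changed to an image under [cell], as [map_nth]
     requires. *)
  rewrite !(nth_indep _ d (cell 0)) by now rewrite length_map.
  rewrite !map_nth. intros H1 H2. pose proof (cell_unique _ _ _ H1 H2) as E.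
  apply NoDup_nth in E; auto. apply NoDup_filter, NoDup_zrange.
Qed.

Lemma total_length_cells :
  total_length cells = INR (length (filter good (zrange grid))) / IZR grid.
Proof.
  pose proof (IZR_lt _ _ grid_pos) as HN.
  unfold cells. induction (filter good (zrange grid)) as [|m l IH].
  - simpl. lra.
  - cbn [map length]. rewrite S_INR. unfold total_length in *. cbn [fold_right]. rewrite IH.
    unfold ilength, cell; simpl. rewrite plus_IZR. field. lra.
Qed.

(** Divide [count_good] by [grid]: the two bad counts become [1/P] and [(1 - 1/P)^(k+1)]. *)
Lemma total_length_cells_ge :
  1 - / IZR P - (1 - / IZR P) ^ S k <= total_length cells.
Proof.
  rewrite total_length_cells.
  pose proof count_good as H. pose proof (IZR_lt _ _ grid_pos) as HN.
  pose proof (IZR_lt _ _ HP) as HP1. pose proof (IZR_lt _ _ HQ) as HQ0.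
  apply Rmult_le_reg_r with (IZR grid); [lra|].
  unfold Rdiv. rewrite Rmult_assoc, Rinv_l, Rmult_1_r by lra.
  eapply Rle_trans; [|exact H]. unfold grid.
  rewrite !mult_IZR, <- !pow_IZR, minus_IZR.
  replace (1 - / IZR P) with ((IZR P - 1) * / IZR P) by (field; lra).
  rewrite Rpow_mult_distr, pow_inv.
  pose proof (pow_lt (IZR P) (S k) ltac:(lra)).
  apply Req_le. simpl. field. split; [apply pow_nonzero|]; lra.
Qed.

(** * Orbits under multiplication by [P/Q] *)

Lemma cells_orbit (y : R) :
  ~ (forall j : nat, union_of cells (frac (y * (IZR P / IZR Q) ^ j))).
Proof.
  intros H.
  pose proof (H O) as H0. apply union_cells in H0 as [m [Hm [Hg Hx]]].
  apply andb_prop in Hg as [_ Hg]. apply Bool.negb_true_iff in Hg.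
  assert (He : exists e, (e <= k)%nat /\ digit e m = 0%Z).
  { destruct (existsb (fun e => digit e m =? 0)%Z (seq 0 (S k))) eqn:E.
    - apply existsb_exists in E as [e [He Hz]]. apply in_seq in He. apply Z.eqb_eq in Hz.
      exists e. split; [lia|assumption].
    - exfalso. unfold no_zero_digit in Hg. apply Bool.not_true_iff_false in Hg. apply Hg.
      apply forallb_forall. intros e He. apply Bool.negb_true_iff.
      destruct (digit e m =? 0)%Z eqn:E'; [|reflexivity].
      rewrite <- E. symmetry. apply existsb_exists. eauto. }
  destruct He as [e [He Hz]].
  (* The zero digit [d_(k-e)] of the starting point becomes [d_0] after [k - e] steps, where
     goodness of [m'] forbids it. *)
  pose proof (H (k - e)%nat) as H1. apply union_cells in H1 as [m' [Hm' [Hg' Hx']]].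
  apply andb_prop in Hg' as [Hg' _]. apply Bool.negb_true_iff, Z.eqb_neq in Hg'. apply Hg'.
  clear H Hg Hg' Hm Hm'.
  unfold digit in *. rewrite Nat.sub_diag, Z.pow_0_r, Z.mul_1_r.
  pose proof (pow_P_pos e) as Pe. pose proof (pow_Q_pos (k - e)) as Qe. pose proof (pow_P_pos k) as Pk.
  (* [F] is the cofactor of the divisor in [digit e], so [m] divided by that divisor is the integer
     part of [F] times the fractional part of [y]. *)
  set (F := (P ^ Z.of_nat (S (k - e)) * Q ^ Z.of_nat e)%Z).
  assert (E1 : grid = (P ^ Z.of_nat e * Q ^ Z.of_nat (k - e) * F)%Z).
  { unfold grid, F. replace (S k) with (e + S (k - e))%nat by lia.
    replace (Z.of_nat k) with (Z.of_nat (k - e) + Z.of_nat e)%Z by lia.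
    rewrite Nat2Z.inj_add, !Z.pow_add_r by lia. ring. }
  assert (E2 : grid = (P ^ Z.of_nat k * (P * Q ^ Z.of_nat k))%Z).
  { unfold grid. rewrite Nat2Z.inj_succ, Z.pow_succ_r by lia. ring. }
  rewrite E1 in Hx. rewrite E2 in Hx'.
  apply floor_div in Hx; [|nia]. apply floor_div in Hx'; [|lia].
  set (a := (m / (P ^ Z.of_nat e * Q ^ Z.of_nat (k - e)))%Z) in *.
  set (a' := (m' / P ^ Z.of_nat k)%Z) in *.
  apply Z.mod_divide in Hz; [|lia]. destruct Hz as [z Hz].
  unfold frac in Hx, Hx'. rewrite pow_O, Rmult_1_r in Hx.
  set (n := Int_part y) in *. set (n' := Int_part (y * (IZR P / IZR Q) ^ (k - e))) in *.
  (* [P Q^k (P/Q)^(k-e) = F], so the two scaled fractional parts differ only through the integer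
     parts [n] and [n']. Both corrections carry a factor [P], and [c] is what remains. *)
  set (c := (P ^ Z.of_nat (k - e) * Q ^ Z.of_nat e * n - Q ^ Z.of_nat k * n')%Z).
  assert (E3 : IZR (P * Q ^ Z.of_nat k) * (y * (IZR P / IZR Q) ^ (k - e) - IZR n')
               = IZR F * (y - IZR n) + IZR (P * c)).
  { unfold F, c. pose proof (IZR_lt _ _ HQ).
    rewrite !mult_IZR, minus_IZR, !mult_IZR, <- !pow_IZR.
    unfold Rdiv. rewrite Rpow_mult_distr, pow_inv.
    replace (IZR Q ^ k) with (IZR Q ^ (k - e) * IZR Q ^ e)
      by (rewrite <- pow_add; f_equal; lia).
    simpl. field. apply pow_nonzero. lra. }
  rewrite E3 in Hx'. clear E3.
  (* Both sides are the integer part of the same real number; as [P] divides [a], it divides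
     [a']. *)
  assert (a' = a + P * c)%Z.
  { rewrite !plus_IZR in *.
    assert (a' < a + P * c + 1)%Z by (apply lt_IZR; rewrite !plus_IZR; lra).
    assert (a + P * c < a' + 1)%Z by (apply lt_IZR; rewrite !plus_IZR; lra). lia. }
  apply Z.mod_divide; [lia|]. exists (z + c)%Z. lia.
Qed.

End Digits.

(** * Choice of the exponent [s] and of [k] *)

Theorem theorem4 (p q : Z) (hq : (1 < q)%Z) (hpq : (q < p)%Z) (hcop : Z.gcd p q = 1%Z)
  (eps : R) (heps : 0 < eps) :
  exists L : list interval,
    (forall I, In I L -> lo I <= hi I) /\
    pairwise_disjoint L /\
    (forall x, union_of L x -> 0 <= x < 1) /\
    1 - eps <= total_length L /\
    (forall xi : R, ~ Zpq p q (union_of L) xi).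
Proof.
  assert (Hp : 1 < IZR p) by (apply (IZR_lt 1); lia).
  assert (Hq : 1 < IZR q) by (apply (IZR_lt 1); lia).
  (* The bound makes [1/P] at most [eps / 2], and [s > 0] gives [P > 1]. *)
  assert (Hs : exists s : nat, (0 < s)%nat /\ 2 / eps < IZR p ^ s).
  { destruct (Pow_x_infinity (IZR p)) with (b := 2 / eps + 1) as [s Hs].
    - rewrite Rabs_pos_eq; lra.
    - exists (S s). split; [lia|]. specialize (Hs (S s) ltac:(lia)).
      rewrite Rabs_pos_eq in Hs by (apply pow_le; lra). lra. }
  destruct Hs as [s [Hs0 Hs]].
  set (P := (p ^ Z.of_nat s)%Z). set (Q := (q ^ Z.of_nat s)%Z).
  assert (HP : (1 < P)%Z) by (apply Z.pow_gt_1; lia).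
  assert (HQ : (0 < Q)%Z) by (apply Z.pow_pos_nonneg; lia).
  assert (HPQ : rel_prime P Q).
  { apply rel_prime_Zpower; try lia. now apply Zgcd_1_rel_prime. }
  assert (HPR : IZR P = IZR p ^ s) by (unfold P; now rewrite pow_IZR).
  assert (HQR : IZR Q = IZR q ^ s) by (unfold Q; now rewrite pow_IZR).
  assert (HP1 : 1 < IZR P) by (apply (IZR_lt 1); lia).
  assert (HinvP : / IZR P <= eps / 2).
  { replace (eps / 2) with (/ (2 / eps)) by (field; lra).
    apply Rinv_le_contravar; [apply Rdiv_lt_0_compat; lra|]. rewrite HPR. lra. }
  assert (HinvP' : 0 < / IZR P < 1).
  { split; [apply Rinv_0_lt_compat; lra|]. rewrite <- Rinv_1. apply Rinv_lt_contravar; lra. }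
  (* With [P] fixed, [k] brings the other loss, [(1 - 1/P)^(k+1)], below [eps / 2]. *)
  destruct (pow_lt_1_zero (1 - / IZR P)) with (y := eps / 2) as [k Hk].
  { rewrite Rabs_pos_eq; lra. }
  { lra. }
  specialize (Hk (S k) ltac:(lia)). rewrite Rabs_pos_eq in Hk by (apply pow_le; lra).
  pose proof (grid_pos P Q k HP HQ) as HN. apply IZR_lt in HN.
  exists (cells P Q k). split; [|split; [|split; [|split]]].
  - intros I HI. apply in_map_iff in HI as [m [<- _]]. simpl.
    apply Rmult_le_compat_r; [left; now apply Rinv_0_lt_compat|apply IZR_le; lia].
  - now apply cells_disjoint.
  - intros x Hx. apply union_cells in Hx as [m [[Hm0 Hm1] [_ [H1 H2]]]]; auto.
    apply IZR_le in Hm0.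
    assert (IZR (m + 1) <= IZR (grid P Q k)) by (apply IZR_le; lia).
    split; nra.
  - pose proof (total_length_cells_ge P Q k HP HQ HPQ). lra.
  - intros xi [_ H]. apply (cells_orbit P Q k HP HQ xi). intros j.
    (* The orbit under [P/Q] is the subsequence of the [p/q] orbit at the times [s * j]. *)
    replace ((IZR P / IZR Q) ^ j) with ((IZR p / IZR q) ^ (s * j)); [apply H|].
    rewrite pow_mult, HPR, HQR. f_equal. unfold Rdiv. now rewrite Rpow_mult_distr, pow_inv.
Qed.
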